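(* Let $a,b$ be positive integers. Let $P_{n,\ell}^{(a,b)}$ be the total number of points at level $\ell$ over all colored $(a,b)$-Dyck paths of length $2n$. Then $P_{0,0}^{(a,b)}=1$ and for all integers $n\ge1$ and $0\le\ell\le n$, $$P_{n,\ell}^{(a,b)}=\sum_{j=0}^{n-\ell}\binom{n-\ell}{j}\left\{\frac{2\ell(a-b)}{2n-j}\binom{2n-j}{n-\ell}+\frac{2(\ell+1)b}{2n-j+2}\binom{2n-j+2}{n-\ell}\right\}(a-b)^{j}b^{n-j-1}.$$ Moreover, for all $n,\ell\ge0$, $P_{n,\ell}^{(a,b)}+\frac{a-b}{b}\delta_{n,0}$ is the $(n,\ell)$-entry of the Riordan array $\left(C(a,b;x)^2+\frac{a-b}{b},\ bxC(a,b;x)^2\right)$, i.e. it equals $[x^n]\left(C(a,b;x)^2+\frac{a-b}{b}\right)\left(bxC(a,b;x)^2\right)^{\ell}$.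
   Context: A Dyck path of length $2n$ is a lattice path from $(0,0)$ to $(2n,0)$ weakly above the $x$-axis with steps $\mathbf{u}=(1,1)$, $\mathbf{d}=(1,-1)$. A colored $(a,b)$-Dyck path is a Dyck path in which each $\mathbf{d}$-step that is part of a peak (i.e. immediately preceded by a $\mathbf{u}$-step) is colored with one of $a$ colors and every other $\mathbf{d}$-step is colored with one of $b$ colors. A point at level $\ell$ is a lattice point of the path with ordinate $\ell$. $C(a,b;x)=\frac{1-(a-b)x-\sqrt{(1-(a-b)x)^2-4bx}}{2bx}$ is the unique power series with $C=1+(a-b)xC+bxC^2$. $\delta_{n,0}=1$ if $n=0$, else $0$. A Riordan array $(d(x),h(x))$ has $(n,k)$-entry $[x^n]d(x)h(x)^k$.
   Formalization: In the Riordan part the correction (a-b)/b·δ_{n,0} is replaced by (a-b)/b·δ_{n,0}δ_{ℓ,0}, since the identity as written fails at n=0<ℓ whenever a≠b (for example a=2, b=1, n=0, ℓ=1 gives 1 on the left and 0 on the right). *)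

(* Defs.v *)
From HB Require Import structures.
From mathcomp Require Import all_boot all_order all_algebra.
From mathcomp Require Import boolp.
From mathcomp Require Import ring.

Set Implicit Arguments.
Unset Strict Implicit.
Unset Printing Implicit Defensive.

Import Order.TTheory GRing.Theory Num.Theory.
Local Open Scope ring_scope.

Record fps (R : comNzRingType) := Fps { fcoef : nat -> R }.

Section FpsRing.
Variable R : comNzRingType.
Implicit Types f g h : fps R.

Lemma fpsP f g : (forall n, fcoef f n = fcoef g n) <-> f = g.
Proof.
split=> [|->//]; case: f g => [f] [g] /= e.
by congr Fps; apply/funext.
Qed.

HB.instance Definition _ := gen_eqMixin (fps R).
HB.instance Definition _ := gen_choiceMixin (fps R).

Definition fps_const (c : R) : fps R := Fps (fun n => c *+ (n == 0)%N).
Definition fpsX : fps R := Fps (fun n => (n == 1)%N%:R).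
Definition fps_add f g := Fps (fun n => fcoef f n + fcoef g n).
Definition fps_opp f := Fps (fun n => - fcoef f n).
Definition fps_mul f g :=
  Fps (fun n => \sum_(i < n.+1) fcoef f i * fcoef g (n - i)%N).

Lemma fps_addA : associative fps_add.
Proof. by move=> f g h; apply/fpsP=> n /=; rewrite addrA. Qed.
Lemma fps_addC : commutative fps_add.
Proof. by move=> f g; apply/fpsP=> n /=; rewrite addrC. Qed.
Lemma fps_add0 : left_id (fps_const 0) fps_add.
Proof. by move=> f; apply/fpsP=> n /=; rewrite mul0rn add0r. Qed.
Lemma fps_addN : left_inverse (fps_const 0) fps_opp fps_add.
Proof. by move=> f; apply/fpsP=> n /=; rewrite mul0rn addNr. Qed.

HB.instance Definition _ :=
  GRing.isZmodule.Build (fps R) fps_addA fps_addC fps_add0 fps_addN.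

Definition fps_trunc (N : nat) f : {poly R} := \poly_(i < N) fcoef f i.

Lemma fcoef_mul_trunc f g n (p q : {poly R}) :
  (forall i, (i <= n)%N -> p`_i = fcoef f i) ->
  (forall i, (i <= n)%N -> q`_i = fcoef g i) ->
  fcoef (fps_mul f g) n = (p * q)`_n.
Proof.
move=> hp hq; rewrite coefM /=; apply: eq_bigr => i _.
by rewrite hp ?hq ?leq_subr // -ltnS.
Qed.

Lemma coef_trunc N f i : (i < N)%N -> (fps_trunc N f)`_i = fcoef f i.
Proof. by move=> h; rewrite coef_poly h. Qed.

Lemma fps_mulA : associative fps_mul.
Proof.
move=> f g h; apply/fpsP=> n.
pose t := fps_trunc n.+1.
rewrite (@fcoef_mul_trunc f _ n (t f) (t g * t h)).
- rewrite (@fcoef_mul_trunc _ h n (t f * t g) (t h)) ?mulrA // => i hi.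
    by rewrite (@fcoef_mul_trunc f g i (t f) (t g)) // => k hk;
      rewrite coef_trunc // ltnS (leq_trans hk).
  by rewrite coef_trunc.
- by move=> i hi; rewrite coef_trunc.
- move=> i hi; rewrite (@fcoef_mul_trunc g h i (t g) (t h)) // => k hk;
    by rewrite coef_trunc // ltnS (leq_trans hk).
Qed.

Lemma fps_mulC : commutative fps_mul.
Proof.
move=> f g; apply/fpsP=> n; pose t := fps_trunc n.+1.
rewrite (@fcoef_mul_trunc f g n (t f) (t g)) 1?(@fcoef_mul_trunc g f n (t g) (t f)) 1?mulrC //;
  by move=> i hi; rewrite coef_trunc.
Qed.

Lemma fps_mul1 : left_id (fps_const 1) fps_mul.
Proof.
move=> f; apply/fpsP=> n /=.
by rewrite big_ord_recl /= mul1r subn0 big1 ?addr0 // => i _; rewrite mul0r.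
Qed.

Lemma fps_mulDl : left_distributive fps_mul fps_add.
Proof.
move=> f g h; apply/fpsP=> n /=.
by rewrite -big_split /=; apply: eq_bigr => i _; rewrite mulrDl.
Qed.

Lemma fps_one_neq0 : fps_const 1 != 0 :> fps R.
Proof.
apply/eqP=> /fpsP /(_ 0%N) /= /eqP.
by rewrite !mulr1n (negPf (oner_neq0 R)).
Qed.

HB.instance Definition _ := GRing.Zmodule_isComNzRing.Build (fps R)
  fps_mulA fps_mulC fps_mul1 fps_mulDl fps_one_neq0.

Lemma fcoef0 n : fcoef (0 : fps R) n = 0.
Proof. by rewrite /= mul0rn. Qed.
Lemma fcoef1 n : fcoef (1 : fps R) n = (n == 0)%N%:R.
Proof. by []. Qed.
Lemma fcoefC c n : fcoef (fps_const c) n = c *+ (n == 0)%N.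
Proof. by []. Qed.
Lemma fcoefD f g n : fcoef (f + g) n = fcoef f n + fcoef g n.
Proof. by []. Qed.
Lemma fcoefN f n : fcoef (- f) n = - fcoef f n.
Proof. by []. Qed.
Lemma fcoefM f g n :
  fcoef (f * g) n = \sum_(i < n.+1) fcoef f i * fcoef g (n - i)%N.
Proof. by []. Qed.

Lemma fcoefCM c f n : fcoef (fps_const c * f) n = c * fcoef f n.
Proof.
rewrite fcoefM big_ord_recl /= mulr1n subn0 big1 ?addr0 // => i _.
by rewrite mulr0n mul0r.
Qed.

Lemma fcoefXM f n :
  fcoef (fpsX * f) n = if n is m.+1 then fcoef f m else 0.
Proof.
rewrite fcoefM big_ord_recl /= mul0r add0r.
case: n => [|n]; first by rewrite big_ord0.
rewrite big_ord_recl /= mul1r subSS subn0 big1 ?addr0 // => i _.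
by rewrite mul0r.
Qed.

Definition riordan (d h : fps R) (n k : nat) : R := fcoef (d * h ^+ k) n.

End FpsRing.

(* C(a,b;x), by the coefficient recurrence read off from
   C = 1 + (a - b) x C + b x C^2; see Cab_eq, Cab_uniq and Cab_closed. *)

Section CatalanLike.
Variables (R : comNzRingType) (a b : R).

Fixpoint Cab_seq (n : nat) : seq R :=
  if n is m.+1 then
    let s := Cab_seq m in
    rcons s ((a - b) * s`_m + b * \sum_(i < m.+1) s`_i * s`_(m - i))
  else [:: 1].

Definition Cab : fps R := Fps (fun n => (Cab_seq n)`_n).

Lemma size_Cab_seq n : size (Cab_seq n) = n.+1.
Proof. by elim: n => //= n IH; rewrite size_rcons IH. Qed.

Lemma nth_Cab_seq n i : (i <= n)%N -> (Cab_seq n)`_i = fcoef Cab i.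
Proof.
elim: n => [|n IH]; first by rewrite leqn0 => /eqP->.
rewrite leq_eqVlt => /predU1P[->//|]; rewrite ltnS => hi /=.
by rewrite nth_rcons size_Cab_seq ltnS hi IH.
Qed.

Lemma fcoef_Cab0 : fcoef Cab 0 = 1.
Proof. by []. Qed.

Lemma fcoef_CabS n : fcoef Cab n.+1 =
  (a - b) * fcoef Cab n
  + b * \sum_(i < n.+1) fcoef Cab i * fcoef Cab (n - i)%N.
Proof.
rewrite [LHS]/= nth_rcons size_Cab_seq ltnn eqxx; congr (_ + b * _).
by apply: eq_bigr => i _; rewrite !nth_Cab_seq ?leq_subr // -ltnS.
Qed.

Lemma fcoef_rhs (F : fps R) n :
  fcoef (1 + fps_const (a - b) * fpsX R * F
           + fps_const b * fpsX R * F ^+ 2) n =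
  if n is m.+1 then
    (a - b) * fcoef F m + b * \sum_(i < m.+1) fcoef F i * fcoef F (m - i)%N
  else 1.
Proof.
rewrite expr2 -!mulrA !fcoefD fcoef1 !fcoefCM !fcoefXM.
by case: n => [|n]; rewrite ?mulr0 ?addr0 // add0r fcoefM.
Qed.

Lemma Cab_eq :
  Cab = 1 + fps_const (a - b) * fpsX R * Cab
          + fps_const b * fpsX R * Cab ^+ 2.
Proof.
by apply/fpsP=> -[|n]; rewrite fcoef_rhs ?fcoef_Cab0 ?fcoef_CabS.
Qed.

Lemma Cab_uniq (F : fps R) :
  F = 1 + fps_const (a - b) * fpsX R * F
        + fps_const b * fpsX R * F ^+ 2 -> F = Cab.
Proof.
move=> hF; apply/fpsP=> n.
elim/ltn_ind: n => -[|n] IH; rewrite hF fcoef_rhs ?fcoef_Cab0 ?fcoef_CabS //.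
rewrite IH //; congr (_ + b * _); apply: eq_bigr => i _.
by rewrite !IH // ltnS ?leq_subr // -ltnS.
Qed.

Lemma Cab_closed : exists S : fps R,
  [/\ fcoef S 0 = 1,
      S ^+ 2 = (1 - fps_const (a - b) * fpsX R) ^+ 2
               - 4%:R * fps_const b * fpsX R
    & 2%:R * fps_const b * fpsX R * Cab
      = 1 - fps_const (a - b) * fpsX R - S].
Proof.
pose u := fps_const (a - b) * fpsX R; pose v := fps_const b * fpsX R.
exists (1 - u - 2%:R * v * Cab); split.
- rewrite !fcoefD !fcoefN -!mulrA !fcoefCM fcoef1.
  rewrite -[fcoef (fpsX R) 0]/(0 : R) mulr0 oppr0 addr0.
  rewrite fcoefM big_ord1 fcoefCM fcoefXM.
  by rewrite !mulr0 oppr0 addr0.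
- have e : Cab = 1 + u * Cab + v * Cab ^+ 2 := Cab_eq.
  have -> : (1 - u - 2%:R * v * Cab) ^+ 2 =
    (1 - u) ^+ 2 - 4%:R * v
    - 4%:R * v * (Cab - (1 + u * Cab + v * Cab ^+ 2)) by ring.
  by rewrite -e subrr mulr0 subr0 mulrA.
- by rewrite /u /v; ring.
Qed.

End CatalanLike.

(* Colored Dyck paths, as words: [None] is a u-step, [Some (inl c)] a d-step
   with one of the a peak colors, [Some (inr c)] a d-step with one of the b
   other colors. *)

Section ColoredDyck.
Variables a b : nat.

Definition cstep := option ('I_a + 'I_b).

Definition is_up (s : cstep) : bool := ~~ isSome s.
Definition is_peak_colored (s : cstep) : bool :=
  if s is Some (inl _) then true else false.

Definition ordinate (w : seq cstep) (i : nat) : int :=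
  (count is_up (take i w))%:Z - (count (predC is_up) (take i w))%:Z.

Definition is_dyck (w : seq cstep) : bool :=
  all (fun i => 0 <= ordinate w i) (iota 0 (size w).+1)
  && (ordinate w (size w) == 0).

Definition well_colored (w : seq cstep) : bool :=
  all (fun i => let s := nth None w i in
         ~~ is_up s ==>
         (is_peak_colored s == ((0 < i)%N && is_up (nth None w i.-1))))
      (iota 0 (size w)).

Definition colored_dyck (n : nat) : {set (2 * n).-tuple cstep} :=
  [set w : (2 * n).-tuple cstep | is_dyck w && well_colored w].

Definition num_points (l : nat) (w : seq cstep) : nat :=
  count (fun i => ordinate w i == l%:Z) (iota 0 (size w).+1).

Definition dyck_points (n l : nat) : nat :=
  \sum_(w in colored_dyck n) num_points l w.

End ColoredDyck.

(* Main.v *)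
(* A path with a marked point at level l splits into a prefix from height 0 to
   height l and a suffix from l back to 0; the colors interact across the cut
   only through whether the prefix ends with an up-step.  Counting prefixes and
   suffixes letter by letter gives linear systems of power series in t, one
   power of t per step, whose solutions are monomials in t and K = C(t^2) up to
   a factor K - 1 or a - b + b K.  Pairing prefixes with suffixes gives
   x^l b^(l-1) C^(2l) (a - b + b C^2) with x = t^2, which is the Riordan entry.
   The coefficients of C^k follow from the recurrence
   C^(k+1) = C^k + (a-b) x C^(k+1) + b x C^(k+2). *)
Require Import Defs.
From mathcomp Require Import all_boot all_order all_algebra ring zify.

Set Implicit Arguments.
Unset Strict Implicit.
Unset Printing Implicit Defensive.

Import Order.TTheory GRing.Theory Num.Theory.
Local Open Scope ring_scope.

(** * Coefficients of the powers of $C$ *)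

Lemma Cab_exprS (R : comNzRingType) (a b : R) (k : nat) :
  Cab a b ^+ k.+1 = Cab a b ^+ k + fps_const (a - b) * (fpsX R * Cab a b ^+ k.+1)
                    + fps_const b * (fpsX R * Cab a b ^+ k.+2).
Proof.
set C := Cab a b.
rewrite [in LHS]exprS {1}/C Cab_eq -/C !exprS; ring.
Qed.

(* The positivity hypothesis excludes [m = k = 0], where the junk value [0 / 0 = 0]
   makes the right-hand side [0]. *)
Lemma fcoef_Cab_expr (F : numFieldType) (a b : F) (m k : nat) : (0 < m + k)%N ->
  fcoef (Cab a b ^+ k) m =
  \sum_(j < m.+1) 'C(m, j)%:R * (k%:R / (2 * m + k - j)%N%:R * 'C(2 * m + k - j, m)%:R)
                  * (a - b) ^+ j * b ^+ (m - j).
Proof.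
have Cab0 k' : fcoef (Cab a b ^+ k') 0 = 1.
  elim: k' => [|k' IH]; first by rewrite expr0.
  by rewrite exprS fcoefM big_ord1 IH mulr1.
(* By the recurrence, the coefficient of $C^{k+1}$ at $m+1$ needs $C^k$ at $m+1$ and $C^{k+1}$,
   $C^{k+2}$ at $m$. Hence an outer induction on [m] for all [k] and an inner one on [k]. *)
elim: m k => [|m IHm] k mk_gt0.
  rewrite Cab0 big_ord1 bin0 muln0 add0n subn0 bin0 subnn !expr0 !mulr1 mul1r.
  by rewrite divff // pnatr_eq0 -lt0n.
elim: k {mk_gt0} => [|k IHk].
  rewrite expr0 fcoef1 big1 // => j _.
  by rewrite mul0r mul0r mulr0 !mul0r.
have [mk1 mk2] : (0 < m + k.+1)%N /\ (0 < m + k.+2)%N by lia.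
rewrite Cab_exprS !fcoefD !fcoefCM !fcoefXM IHk ?addSn // (IHm _ mk1) (IHm _ mk2).
have lhs_split : forall G : nat -> F, \sum_(j < m.+2) G j = G 0%N + \sum_(j < m.+1) G j.+1.
  by move=> G; rewrite big_ord_recl.
pose c M j (q : nat) : F := 'C(m, j)%:R * (q%:R / M%:R * 'C(M, m)%:R).
(* [s2] and [s3] are the summands of the two order-$m$ terms, indexed by the power of $a-b$. The
   extra factor $a-b$ shifts [s2] by one, so it starts with 0. *)
pose s2 j : F :=
  if j is i.+1 then c (2 * m + k.+1 - i)%N i k.+1 * (a - b) ^+ j * b ^+ (m.+1 - j) else 0.
pose s3 j : F := c (2 * m + k.+2 - j)%N j k.+2 * (a - b) ^+ j * b ^+ (m.+1 - j).
have -> : (a - b) * (\sum_(j < m.+1) 'C(m, j)%:R * (k.+1%:R / (2 * m + k.+1 - j)%N%:R *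
     'C(2 * m + k.+1 - j, m)%:R) * (a - b) ^+ j * b ^+ (m - j)) = \sum_(j < m.+2) s2 j.
  rewrite lhs_split add0r mulr_sumr; apply: eq_bigr => j _.
  by rewrite /s2 /c subSS exprS; ring.
have -> : b * (\sum_(j < m.+1) 'C(m, j)%:R * (k.+2%:R / (2 * m + k.+2 - j)%N%:R *
     'C(2 * m + k.+2 - j, m)%:R) * (a - b) ^+ j * b ^+ (m - j)) = \sum_(j < m.+2) s3 j.
  rewrite [RHS]big_ord_recr /= {2}/s3 /c bin_small // !mul0r addr0 mulr_sumr.
  apply: eq_bigr => j _.
  by rewrite /s3 /c subSn -1?ltnS // exprS; ring.
rewrite -!big_split /=; apply: eq_bigr => -[j /= lejm] _.
rewrite ltnS in lejm.
pose M := (2 * m + k.+2 - j)%N.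
have -> : (2 * m.+1 + k.+1 - j = M.+1)%N by rewrite /M; lia.
have -> : (2 * m.+1 + k - j = M)%N by rewrite /M; lia.
(* Pascal's rule in weighted form: $\binom{m}{j-1}$ and $\binom{m}{j}$ are the fractions $j/(m+1)$
   and $(m+1-j)/(m+1)$ of $\binom{m+1}{j}$, which becomes a common factor. *)
have -> : s2 j = ('C(m.+1, j)%:R * j%:R / m.+1%:R)
    * (k.+1%:R / M%:R * 'C(M, m)%:R) * (a - b) ^+ j * b ^+ (m.+1 - j).
  case: j lejm @M => [|i] lejm M; first by rewrite mulr0 !mul0r.
  rewrite /s2 /c (_ : 2 * m + k.+1 - i = M)%N; last by rewrite /M; lia.
  congr (_ * _ * _ * _).
  have /(congr1 (fun n => n%:R : F)) := mul_bin_diag m.+1 i; rewrite !natrM /= => E.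
  by rewrite [_ * i.+1%:R]mulrC -E mulrAC divff ?mul1r ?pnatr_eq0.
have -> : s3 j = ('C(m.+1, j)%:R * (m.+1 - j)%N%:R / m.+1%:R)
    * (k.+2%:R / M%:R * 'C(M, m)%:R) * (a - b) ^+ j * b ^+ (m.+1 - j).
  rewrite /s3 /c -/M; congr (_ * _ * _ * _).
  have /(congr1 (fun n => n%:R : F)) := mul_bin_down m.+1 j; rewrite !natrM /= => E.
  by rewrite [_ * (_ - _)%N%:R]mulrC -E mulrAC divff ?mul1r ?pnatr_eq0.
rewrite -!mulrDl; congr (_ * _ * _).
have M0 : M%:R != 0 :> F by rewrite pnatr_eq0 /M; lia.
have m0 : m.+1%:R != 0 :> F by rewrite pnatr_eq0.
have M10 : M.+1%:R != 0 :> F by rewrite pnatr_eq0.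
have -> : 'C(M.+1, m.+1)%:R = M.+1%:R * 'C(M, m)%:R / m.+1%:R :> F.
  by apply: (mulIf m0); rewrite mulfVK // -!natrM mul_bin_diag mulnC.
have -> : 'C(M, m.+1)%:R = (M - m)%N%:R * 'C(M, m)%:R / m.+1%:R :> F.
  by apply: (mulIf m0); rewrite mulfVK // -!natrM mulnC mul_bin_left.
have EM : M%:R = 2 * m%:R + k%:R + 2 - j%:R :> F.
  by rewrite /M natrB; [rewrite natrD (natrM F 2 m) -addn2 natrD; ring | lia].
have lemM : (m <= M)%N by rewrite /M; lia.
rewrite (natrB _ lemM) (natrB _ lejm).
have EM1 : M.+1%:R = M%:R + 1 :> F by rewrite -natr1.
clearbody M; rewrite EM1 in M10 *; rewrite -!(natr1 k.+1) -!(natr1 k) -!(natr1 m) in m0 *.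
move: ('C(m.+1, j)%:R) ('C(M, m)%:R) => u v.
(* The denominators involve [M], so [j] is eliminated in its favor; a rational identity in
   independent variables remains. *)
have -> : j%:R = 2 * m%:R + k%:R + 2 - M%:R :> F by rewrite EM; ring.
by field; rewrite M10 M0 m0.
Qed.

(** * The substitution $x \mapsto x^2$ in power series *)

Section SubstSquare.
Variable R : comNzRingType.
Implicit Types f g : fps R.

(* The substitution f(x) |-> f(x^2), not the square of f. *)
Definition fps_sq f : fps R := Fps (fun n => if odd n then 0 else fcoef f n./2).

Lemma fps_sqD f g : fps_sq (f + g) = fps_sq f + fps_sq g.
Proof. by apply/fpsP=> n; rewrite fcoefD /=; case: ifP; rewrite ?addr0. Qed.

Lemma fps_sqN f : fps_sq (- f) = - fps_sq f.
Proof. by apply/fpsP=> n; rewrite fcoefN /=; case: ifP; rewrite ?oppr0. Qed.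

Lemma fps_sqC c : fps_sq (fps_const c) = fps_const c.
Proof. by apply/fpsP=> -[|[|n]] //=; case: ifP. Qed.

Lemma fps_sqX : fps_sq (fpsX R) = fpsX R * fpsX R.
Proof.
apply/fpsP=> n; rewrite fcoefXM; by case: n => [|[|[|[|n]]]] //=; case: ifP.
Qed.

Lemma big_ord_odd_double (V : nmodType) (F : nat -> V) n :
  \sum_(i < n.+1.*2) F i = \sum_(i < n.+1) F i.*2 + \sum_(i < n.+1) F i.*2.+1.
Proof.
elim: n => [|n IH]; first by rewrite big_ord_recr !big_ord1.
rewrite [n.+2.*2]doubleS [LHS]big_ord_recr [X in X + _ = _]big_ord_recr !(big_ord_recr n.+1) /= IH.
by rewrite -!addrA; congr (_ + _); rewrite addrCA.
Qed.

Lemma fps_sqM f g : fps_sq (f * g) = fps_sq f * fps_sq g.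
Proof.
apply/fpsP=> n; rewrite fcoefM /=; case: ifP => odd_n.
  rewrite big1 // => -[i /= lein] _; case: ifP => odd_i; first by rewrite mul0r.
  by rewrite oddB // odd_n odd_i mulr0.
have -> : n = n./2.*2 by rewrite -[LHS]odd_double_half odd_n.
set m := n./2; rewrite doubleK.
pose G i := (if odd i then 0 else fcoef f i./2) *
            (if odd (m.*2 - i)%N then 0 else fcoef g (m.*2 - i)./2).
have G_odd i : odd i -> G i = 0 by rewrite /G => ->; rewrite mul0r.
(* One vanishing term of odd index $2m+1$ is appended so that the indices pair up by parity. *)
transitivity (\sum_(i < m.+1.*2) G i).
  rewrite big_ord_odd_double [X in _ + X]big1 ?addr0.
    by apply: eq_bigr => i _; rewrite /G -doubleB !odd_double !doubleK.
  by move=> i _; rewrite G_odd //= odd_double.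
by rewrite doubleS big_ord_recr /= G_odd ?addr0 //= odd_double.
Qed.

Lemma fps_sq1 : fps_sq 1 = 1. Proof. exact: fps_sqC. Qed.

Lemma fps_sq_exp f k : fps_sq (f ^+ k) = fps_sq f ^+ k.
Proof. by elim: k => [|k IH]; rewrite ?fps_sq1 // !exprS fps_sqM IH. Qed.

Lemma fcoef_sq f n : fcoef (fps_sq f) (2 * n) = fcoef f n.
Proof. by rewrite /= mul2n odd_double doubleK. Qed.

End SubstSquare.

(** * Sums over words of fixed length *)

Section TupleSum.
Variables (V : nmodType) (T : finType).

Lemma sum_tuple0 (f : seq T -> V) : \sum_(w : 0.-tuple T) f w = f [::].
Proof.
by rewrite (big_pred1 [tuple]) // => w; rewrite (tuple0 w) inE eqxx.
Qed.

Lemma sum_tuple_cons (f : seq T -> V) n :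
  \sum_(w : n.+1.-tuple T) f w = \sum_(x : T) \sum_(w : n.-tuple T) f (x :: w).
Proof.
rewrite pair_bigA /= (reindex (fun p : T * n.-tuple T => [tuple of p.1 :: p.2])) //=.
exists (fun w => (thead w, [tuple of behead w])) => [[x w] _|w _] /=.
  by congr (_, _); apply: val_inj.
by rewrite [RHS]tuple_eta; apply: val_inj.
Qed.

Lemma sum_tuple_cat (f : seq T -> V) m n :
  \sum_(w : (m + n).-tuple T) f w =
  \sum_(u : m.-tuple T) \sum_(v : n.-tuple T) f (u ++ v).
Proof.
elim: m f => [|m IH] f.
  by rewrite (sum_tuple0 (fun u => \sum_(v : n.-tuple T) f (u ++ v))).
rewrite (sum_tuple_cons f) (sum_tuple_cons (fun u => \sum_(v : n.-tuple T) f (u ++ v))).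
by apply: eq_bigr => x _; rewrite (IH (fun w => f (x :: w))).
Qed.

Lemma sum_tuple_split (f : seq T -> V) m n : (m <= n)%N ->
  \sum_(w : n.-tuple T) f w =
  \sum_(u : m.-tuple T) \sum_(v : (n - m).-tuple T) f (u ++ v).
Proof. by move=> lemn; rewrite -sum_tuple_cat subnKC. Qed.

Lemma sum_tuple_rcons (f : seq T -> V) n :
  \sum_(w : n.+1.-tuple T) f w = \sum_(w : n.-tuple T) \sum_(x : T) f (rcons w x).
Proof.
rewrite -addn1 sum_tuple_cat; apply: eq_bigr => u _.
rewrite (sum_tuple_cons (fun v => f (u ++ v))); apply: eq_bigr => x _.
by rewrite (sum_tuple0 (fun v => f (u ++ x :: v))) cats1.
Qed.

End TupleSum.

(** * Reading colored Dyck paths letter by letter *)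

Section Automaton.
Variables a b : nat.
Notation step := (cstep a b).

(* The current height, and whether the last step went up. *)
Definition state := (nat * bool)%type.

(** The color of a d-step is constrained only by the letter just before it, so one bit beside the
    height decides legality. [None] is rejection. *)
Definition advance (p : state) (x : step) : option state :=
  match x, p with
  | None, (h, _) => Some (h.+1, true)
  | Some c, (h.+1, u) => if is_peak_colored x == u then Some (h, false) else None
  | Some _, (0%N, _) => None
  end.

Definition run (p : state) (w : seq step) : option state :=
  foldl (fun o x => obind (advance^~ x) o) (Some p) w.

Lemma run_cat p (u v : seq step) : run p (u ++ v) = obind (run^~ v) (run p u).
Proof.
by rewrite /run foldl_cat; case: (foldl _ _ u) => //=; elim: v.
Qed.

Lemma run_rcons p (w : seq step) x : run p (rcons w x) = obind (advance^~ x) (run p w).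
Proof. by rewrite -cats1 run_cat. Qed.

Lemma run_cons p x (w : seq step) : run p (x :: w) = obind (run^~ w) (advance p x).
Proof. by rewrite -cat1s run_cat. Qed.

(** These are the conditions on a colored Dyck path that pass to prefixes; the return to level 0 is
    left out. *)
Definition valid (w : seq step) : bool :=
  all (fun i => 0 <= ordinate w i) (iota 0 (size w).+1) && well_colored w.

Lemma ordinate_rcons (w : seq step) x i : (i <= size w)%N ->
  ordinate (rcons w x) i = ordinate w i.
Proof. by move=> lei; rewrite /ordinate -cats1 takel_cat. Qed.

Lemma ordinate_rcons_size (w : seq step) x :
  ordinate (rcons w x) (size w).+1 =
  ordinate w (size w) + (if is_up x then 1 else -1).
Proof.
rewrite /ordinate -{1 2}(size_rcons w x) !take_size -cats1 !count_cat /=.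
by case: is_up => /=; lia.
Qed.

Lemma well_colored_rcons (w : seq step) x :
  well_colored (rcons w x) = well_colored w &&
    (~~ is_up x ==> (is_peak_colored x == (0 < size w)%N && is_up (last None w))).
Proof.
rewrite /well_colored size_rcons -(addn1 (size w)) iotaD all_cat /= add0n andbT.
congr (_ && _).
  apply: eq_in_all => i; rewrite mem_iota add0n => /andP[_ lti] /=.
  by rewrite !nth_rcons lti (leq_ltn_trans (leq_pred i)).
rewrite nth_rcons ltnn eqxx; congr (_ ==> (_ == _)).
by case: w => //= y w; rewrite -rcons_cons nth_rcons ltnSn (nth_last None (y :: w)).
Qed.

Lemma valid_rcons (w : seq step) x :
  valid (rcons w x) =
  [&& valid w, 0 <= ordinate w (size w) + (if is_up x then 1 else -1)
    & ~~ is_up x ==> (is_peak_colored x == (0 < size w)%N && is_up (last None w))].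
Proof.
rewrite /valid well_colored_rcons size_rcons -(addn1 (size w).+1) iotaD all_cat.
rewrite [all _ (iota _ 1)]/= andbT add0n ordinate_rcons_size -[LHS]andbA -[RHS]andbA.
congr (_ && _); last by rewrite andbCA.
apply: eq_in_all => i; rewrite mem_iota add0n ltnS => /andP[_ lei].
by rewrite ordinate_rcons.
Qed.

(* The flag is [true] on the empty word, whose junk last letter [None] is an
   up-step; this is harmless, since no down-step is possible at height 0. *)
Lemma run_valid (w : seq step) :
  run (0%N, true) w =
  if valid w then Some (`|ordinate w (size w)|%N, is_up (last None w)) else None.
Proof.
elim/last_ind: w => [|w x IH] //.
rewrite run_rcons IH valid_rcons size_rcons ordinate_rcons_size last_rcons.
case: ifP => //= /andP[/allP /(_ (size w))].
rewrite mem_iota leqnn => /(_ isT).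
have : w = [::] -> ordinate w (size w) = 0 by move->.
case: w {IH} => [_ _ _|y w _]; first by case: x => [[c|c]|].
move: (ordinate _ _) => o; case: o => // h _ _.
case: x => [c|] /=; last by rewrite addn1.
case: h => [|h] //; have -> : h.+1%:Z - 1 = h by lia.
by [].
Qed.

Lemma run_dyck (w : seq step) :
  is_dyck w && well_colored w =
  if run (0%N, true) w is Some (0%N, _) then true else false.
Proof.
rewrite run_valid /is_dyck /valid andbAC.
case: ifP => //= _; case: ordinate => [[|n]|n] //.
Qed.

(** This turns the level of a marked point into a condition on the state at the cut. *)
Lemma run_ordinate (w : seq step) i q : (i <= size w)%N ->
  run (0%N, true) (take i w) = Some q -> ordinate w i = q.1.
Proof.
move=> lei; rewrite run_valid; case: ifP => // /andP[/allP /(_ i)].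
rewrite mem_iota size_takel // leqnn => /(_ isT) h _ [<-] /=.
move: h; rewrite /ordinate [take i (take i w)]take_oversize ?size_takel //; lia.
Qed.

End Automaton.

(** * Recurrences for prefixes and suffixes, and the cut at a marked point *)

Section Counting.
Variables (R : comNzRingType) (a b : nat).
Notation step := (cstep a b).

Lemma sum_cstep (f : step -> R) :
  \sum_x f x = f None + \sum_i f (Some (inl i)) + \sum_j f (Some (inr j)).
Proof.
rewrite (bigD1 None) //= (reindex_omap Some id) => [|[]] //=.
rewrite (eq_bigl xpredT) => [|c]; last by rewrite eqxx.
by rewrite big_sumType /= addrA.
Qed.

Definition ends_at0 (p : state) (v : seq step) : bool :=
  if run p v is Some (0%N, _) then true else false.

Definition prefixes (m : nat) (q : state) : R :=
  \sum_(u : m.-tuple step) (run (0%N, true) u == Some q)%:R.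

Definition suffixes (m : nat) (p : state) : R :=
  \sum_(v : m.-tuple step) (ends_at0 p v)%:R.

Lemma prefixes0 q : prefixes 0 q = (q == (0%N, true))%:R.
Proof.
rewrite /prefixes (sum_tuple0 (fun u => (run (0%N, true) u == Some q)%:R)).
by rewrite /= eq_sym.
Qed.

Lemma suffixes0 p : suffixes 0 p = (p.1 == 0%N)%:R.
Proof.
rewrite /suffixes (sum_tuple0 (fun v => (ends_at0 p v)%:R)).
by case: p => [[|h] s].
Qed.

Lemma prefixes_up m l : prefixes m.+1 (l, true) =
  if l is k.+1 then prefixes m (k, true) + prefixes m (k, false) else 0.
Proof.
rewrite /prefixes (sum_tuple_rcons (fun u => (run (0%N, true) u == Some (l, true))%:R)).
transitivity (\sum_(u : m.-tuple step) if l is k.+1 then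
   (run (0%N, true) u == Some (k, true))%:R + (run (0%N, true) u == Some (k, false))%:R else 0 : R).
  apply: eq_bigr => u _; under eq_bigr => x _ do rewrite run_rcons.
  case: (run _ u) => [[h s]|] /=; last first.
    by rewrite big1 //; case: l => // k; rewrite addr0.
  have no_down (c : 'I_a + 'I_b) : (advance (h, s) (Some c) == Some (l, true))%:R = 0 :> R.
    by case: h => //= h; case: ifP; rewrite // (inj_eq Some_inj) xpair_eqE andbF.
  rewrite sum_cstep [X in _ + X + _]big1 // [X in _ + X]big1 // !addr0 /=.
  case: l {no_down} => // k.
  rewrite !(inj_eq Some_inj) !xpair_eqE eqSS andbT.
  by case: s; rewrite ?andbT ?andbF ?addr0 ?add0r.
case: l => [|k]; first by rewrite big1.
by rewrite big_split.
Qed.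

(** The step before the final d-step decides its number of colors: $a$ after a u-step, $b$ after a
    d-step. *)
Lemma prefixes_down m l : prefixes m.+1 (l, false) =
  a%:R * prefixes m (l.+1, true) + b%:R * prefixes m (l.+1, false).
Proof.
rewrite /prefixes (sum_tuple_rcons (fun u => (run (0%N, true) u == Some (l, false))%:R)).
rewrite !mulr_sumr -big_split; apply: eq_bigr => u _.
under eq_bigr => x _ do rewrite run_rcons.
case: (run _ u) => [[h s]|] /=; last by rewrite big1 // !mulr0 addr0.
rewrite sum_cstep /= !(inj_eq Some_inj) !xpair_eqE andbF add0r.
case: h => [|h]; first by rewrite !big1 // !mulr0.
rewrite eqSS.
have E (n : nat) t : \sum_(i < n) ((if t == s then Some (h, false) else None) == Some (l, false))%:R
    = n%:R * ((h == l) && (s == t))%:R :> R.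
  rewrite sumr_const card_ord [RHS]mulr_natl [s == t]eq_sym.
  by case: (t == s); rewrite ?andbF ?andbT // (inj_eq Some_inj) xpair_eqE eqxx andbT.
by rewrite !E.
Qed.

Lemma suffixesS m h s : suffixes m.+1 (h, s) = suffixes m (h.+1, true) +
  if h is k.+1 then (if s then a else b)%:R * suffixes m (k, false) else 0.
Proof.
rewrite /suffixes (sum_tuple_cons (fun v => (ends_at0 (h, s) v)%:R)).
rewrite sum_cstep -addrA; congr (_ + _).
have E (n : nat) (c : 'I_n -> step) t : (forall i, is_up (c i) = false) ->
    (forall i, is_peak_colored (c i) = t) ->
    \sum_(i < n) \sum_(v : m.-tuple step) (ends_at0 (h, s) (c i :: v))%:R
    = if h is k.+1 then n%:R * \sum_(v : m.-tuple step) ((t == s) && ends_at0 (k, false) v)%:R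
      else 0 :> R.
  move=> down col; under eq_bigr => i _.
    have -> : \sum_(v : m.-tuple step) (ends_at0 (h, s) (c i :: v))%:R =
      if h is k.+1 then \sum_(v : m.-tuple step) ((t == s) && ends_at0 (k, false) v)%:R else 0 :> R.
      have := down i; have := col i; rewrite /ends_at0.
      under [in X in _ -> _ -> X]eq_bigr => v _ do rewrite run_cons.
      case: (c i) => [d|//] dt _; case: h => [|k]; first by rewrite big1.
      by move: dt => /= dt; apply: eq_bigr => v _; rewrite /= dt; case: eqP.
    over.
  case: h => [|k]; first by rewrite big1.
  by rewrite sumr_const card_ord mulr_natl.
rewrite (E a _ true) // (E b _ false) //.
case: h {E} => [|k]; first by rewrite addr0.
case: s; rewrite /=.
  by rewrite [X in _ + _ * X]big1 // mulr0 addr0.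
by rewrite [X in _ * X + _]big1 // mulr0 add0r.
Qed.

(** Exchange the sum over paths with the sum over positions [i] and cut each path at [i]; the two
    products are the two values of the flag there. *)
Lemma dyck_points_split n l : (dyck_points a b n l)%:R =
  \sum_(i < (2 * n).+1) (prefixes i (l, true) * suffixes (2 * n - i) (l, true)
                       + prefixes i (l, false) * suffixes (2 * n - i) (l, false)).
Proof.
pose P (w : seq step) i : R := ((is_dyck w && well_colored w) && (ordinate w i == l%:Z))%:R.
transitivity (\sum_(w : (2 * n).-tuple step) \sum_(i < (2 * n).+1) P w i).
  rewrite /dyck_points big_mkcond natr_sum; apply: eq_bigr => w _.
  rewrite inE /P; case: (_ && _); last by rewrite big1.
  rewrite /num_points size_tuple -sum1_count big_mkcond natr_sum.
  rewrite -[iota 0 _]/(index_iota 0 (2 * n).+1) big_mkord.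
  by apply: eq_bigr => i _; case: ifP.
rewrite exchange_big; apply: eq_bigr => -[i /=]; rewrite ltnS => lei _.
rewrite (sum_tuple_split (P^~ i) lei) /prefixes /suffixes !mulr_suml -big_split.
apply: eq_bigr => u _; rewrite /= !mulr_sumr -big_split; apply: eq_bigr => v _.
rewrite /P run_dyck run_cat /ends_at0 /=.
have := @run_ordinate a b (u ++ v) i.
rewrite size_cat size_tuple leq_addr take_size_cat ?size_tuple //.
case: (run _ u) => [[h s]|_] /=; last by rewrite !mul0r addr0.
move=> /(_ _ isT erefl) ->; rewrite /= eqz_nat !(inj_eq Some_inj) !xpair_eqE.
case: eqP => [->|_]; last by rewrite !andbF !mul0r addr0.
by rewrite andbT; case: s; rewrite /= ?mul1r ?mul0r ?addr0 ?add0r.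
Qed.

End Counting.

(** * Generating functions in the number of steps *)

Section GeneratingFunctions.
Variables (R : comNzRingType) (a b : nat).
Let A : fps R := fps_const a%:R.
Let B : fps R := fps_const b%:R.
Let C : fps R := Cab a%:R b%:R.
Let K : fps R := fps_sq C.
Let t : fps R := fpsX R.

Lemma fps_constB (x y : R) : fps_const (x - y) = fps_const x - fps_const y.
Proof. by apply/fpsP=> n; rewrite fcoefD fcoefN !fcoefC mulrnBl. Qed.

Lemma sq_Cab_eq : K = 1 + t ^+ 2 * K * (A - B + B * K).
Proof.
rewrite {1}/K /C Cab_eq expr2 !fps_sqD !fps_sqM fps_sq1 !fps_sqC !fps_sqX fps_constB.
rewrite -/C -/K -/t -/A -/B; ring.
Qed.

(** Cutting at the last ascents to levels $1,\dots,l$ gives $l$ pairs of a Dyck path and a u-step,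
    then a Dyck path that is empty exactly if no d-step comes last. *)
Definition prefix_gf (l : nat) (up : bool) : fps R :=
  t ^+ l * K ^+ l * (if up then 1 else K - 1).

(** Cut at the first descents to levels $h-1,\dots,0$. Each descent has $b$ colors, except that the
    first has $a$ when it directly follows a u-step: hence $a+b(K-1)$ there. *)
Definition suffix_gf (h : nat) (up : bool) : fps R :=
  if up then if h is k.+1 then B ^+ k * t ^+ h * K ^+ h * (A - B + B * K) else K
  else B ^+ h * t ^+ h * K ^+ h.+1.

Lemma prefixesE m l up : prefixes R a b m (l, up) = fcoef (prefix_gf l up) m.
Proof.
elim: m l up => [|m IH] l up.
  rewrite prefixes0 xpair_eqE /prefix_gf; case: l => [|l].
    rewrite !expr0 !mul1r; case: up => //.
    by rewrite fcoefD fcoefN fcoef1 subrr.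
  by rewrite exprS -!mulrA fcoefXM.
case: up.
  rewrite prefixes_up; case: l => [|l]; first by rewrite /prefix_gf !expr0 !mul1r.
  have -> : prefix_gf l.+1 true = t * (prefix_gf l true + prefix_gf l false).
    by rewrite /prefix_gf !exprS; ring.
  by rewrite fcoefXM fcoefD !IH.
rewrite prefixes_down.
have -> : prefix_gf l false = t * (A * prefix_gf l.+1 true + B * prefix_gf l.+1 false).
  (* The functional equation turns $K-1$ into a multiple of $t^2K$, which supplies the factor $t$
     and the higher level. *)
  rewrite /prefix_gf [in LHS](_ : K - 1 = t ^+ 2 * K * (A - B + B * K)).
    by rewrite !exprS; ring.
  by rewrite [in LHS]sq_Cab_eq; ring.
by rewrite fcoefXM fcoefD !fcoefCM !IH.
Qed.

Lemma suffixesE m h up : suffixes R a b m (h, up) = fcoef (suffix_gf h up) m.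
Proof.
elim: m h up => [|m IH] h up.
  rewrite suffixes0 /suffix_gf; case: h => [|h].
    by case: up; rewrite ?expr0 ?expr1 ?mul1r.
  by case: up; rewrite ![t ^+ _]exprS -!mulrA mulrCA fcoefXM.
have K_eq := sq_Cab_eq.
rewrite suffixesS; case: h => [|h].
  have -> : suffix_gf 0 up = 1 + t * suffix_gf 1 true.
    by rewrite /suffix_gf; case: up; rewrite ?expr1 ?expr0 ?mul1r [LHS]K_eq; ring.
  by rewrite fcoefD fcoefXM fcoef1 add0r addr0 IH.
have -> : suffix_gf h.+1 up =
    t * (suffix_gf h.+2 true + (if up then A else B) * suffix_gf h false).
  rewrite /suffix_gf; case: up.
    (* Only the $K-1$ in $A-B+BK=A+B(K-1)$ is expanded: $A$ accounts for a d-step next, the rest for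
       a u-step. *)
    rewrite [in LHS](_ : A - B + B * K = A + B * (t ^+ 2 * K * (A - B + B * K))).
      by rewrite !exprS; ring.
    by rewrite [in LHS]K_eq; ring.
  by rewrite [K ^+ h.+2]exprS {1}K_eq !exprS; ring.
by rewrite fcoefXM fcoefD !IH; case: up; rewrite fcoefCM.
Qed.

(** For $l>0$ the two flags contribute $A-B+BK$ and $(K-1)BK$ to the last factor, which add up to
    $A-B+BK^2$; at level 0 they give $K+(K-1)K=K^2$. *)
Lemma dyck_points_gf n l : (dyck_points a b n l)%:R =
  fcoef (if l is k.+1 then
           B ^+ k * fpsX R ^+ l * C ^+ (2 * l) * (A - B + B * C ^+ 2)
         else C ^+ 2) n.
Proof.
rewrite dyck_points_split -fcoef_sq.
transitivity (fcoef (prefix_gf l true * suffix_gf l true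
                   + prefix_gf l false * suffix_gf l false) (2 * n)).
  rewrite fcoefD !fcoefM -big_split; apply: eq_bigr => i _.
  by rewrite !prefixesE !suffixesE.
congr fcoef; case: l => [|k]; rewrite /prefix_gf /suffix_gf.
  by rewrite fps_sq_exp -/K !exprS; ring.
rewrite !(fps_sq_exp, fps_sqM, fps_sqD, fps_sqX, fps_sqN, fps_sqC) -/K -/t -/A -/B.
by rewrite mul2n -addnn exprMn !exprD !exprS; ring.
Qed.

End GeneratingFunctions.

(** * The Riordan array and the explicit sum *)

Lemma fps_constM (R : comNzRingType) (x y : R) : fps_const (x * y) = fps_const x * fps_const y.
Proof. by apply/fpsP=> n; rewrite fcoefCM !fcoefC mulrnAr. Qed.

Lemma fps_constX (R : comNzRingType) (x : R) k : fps_const (x ^+ k) = fps_const x ^+ k.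
Proof. by elim: k => [|k IH]; rewrite ?expr0 // !exprS fps_constM IH. Qed.

Lemma fcoefXnM (R : comNzRingType) (f : fps R) k n :
  fcoef (fpsX R ^+ k * f) (k + n) = fcoef f n.
Proof. by elim: k => [|k IH]; rewrite ?mul1r // exprS -mulrA fcoefXM. Qed.

(** Pulling $b$ out of $a-b+bC^2$ completes $b^{l-1}$ to $b^l$. At level 0 the constant $(a-b)/b$ is
    an excess, which the correction term records. *)
Lemma dyck_points_riordan (F : fieldType) (a b n l : nat) : b%:R != 0 :> F ->
  (dyck_points a b n l)%:R + (a%:R - b%:R) / b%:R * ((n == 0)%N && (l == 0)%N)%:R
  = riordan (Cab a%:R b%:R ^+ 2 + fps_const ((a%:R - b%:R) / b%:R))
            (fps_const b%:R * fpsX F * Cab a%:R b%:R ^+ 2) n l.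
Proof.
move=> b0; rewrite /riordan dyck_points_gf; case: l => [|k].
  by rewrite expr0 mulr1 fcoefD fcoefC andbT mulr_natr.
rewrite andbF mulr0 addr0; congr fcoef.
set A := fps_const a%:R; set B := fps_const b%:R; set D := fps_const (_ / _).
have -> : A - B = B * D.
  by rewrite -fps_constB -fps_constM [_ * (_ / _)]mulrC divfK.
by rewrite mul2n -addnn !exprMn !exprD !exprS; ring.
Qed.

Lemma dyck_points_coef (R : comNzRingType) (a b n l : nat) : (0 < l <= n)%N ->
  (dyck_points a b n l)%:R =
  (a%:R - b%:R) * b%:R ^+ l.-1 * fcoef (Cab (a%:R : R) b%:R ^+ (2 * l)) (n - l)
  + b%:R ^+ l * fcoef (Cab a%:R b%:R ^+ (2 * l).+2) (n - l).
Proof.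
case: l => // k /andP[_ lekn].
rewrite dyck_points_gf -{1}(subnKC lekn) succnK.
set C := Cab _ _; set A := fps_const a%:R; set B := fps_const b%:R.
have -> : B ^+ k * fpsX R ^+ k.+1 * C ^+ (2 * k.+1) * (A - B + B * C ^+ 2) =
  fpsX R ^+ k.+1 * ((A - B) * (B ^+ k * C ^+ (2 * k.+1)) + B ^+ k.+1 * C ^+ (2 * k.+1).+2).
  by rewrite !exprS; ring.
by rewrite fcoefXnM fcoefD -fps_constB -!fps_constX !fcoefCM mulrA.
Qed.

Lemma dyck_points_sum (F : numFieldType) (a b n l : nat) :
  (0 < b)%N -> (0 < n)%N -> (l <= n)%N ->
  (dyck_points a b n l)%:R = \sum_(0 <= j < (n - l).+1)
    'C(n - l, j)%:R
    * (2%:R * l%:R * (a%:R - b%:R) / (2 * n - j)%N%:R * 'C(2 * n - j, n - l)%:R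
       + 2%:R * (l.+1)%:R * b%:R / (2 * n - j + 2)%N%:R * 'C(2 * n - j + 2, n - l)%:R)
    * (a%:R - b%:R) ^+ j * (b%:R : F) ^ (n%:Z - j%:Z - 1).
Proof.
move=> b_gt0 n_gt0 leln; have b0 : b%:R != 0 :> F by rewrite pnatr_eq0 -lt0n.
set A : F := a%:R; set B : F := b%:R.
(* The exponent $n-j-1$ is an integer that equals $-1$ when $l=0$ and $j=n$. The second summand
   carries a factor $b$ that absorbs this, whence [B_expzS]; the first vanishes at $l=0$, so
   [B_expz] suffices for it. *)
have B_expz (j e : nat) : (n = j + e.+1)%N -> B ^ (n%:Z - j%:Z - 1) = B ^+ e.
  by move=> ->; rewrite (_ : _ - _ - _ = e%:Z) //; lia.
have B_expzS (j e : nat) : (n = j + e)%N -> B * B ^ (n%:Z - j%:Z - 1) = B ^+ e.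
  by move=> ->; rewrite -{1}[B]expr1z -expfzDr // (_ : 1 + _ = e%:Z) //; lia.
rewrite big_mkord.
have up : B ^+ l * fcoef (Cab A B ^+ (2 * l).+2) (n - l) = \sum_(j < (n - l).+1)
    'C(n - l, j)%:R * (2%:R * (l.+1)%:R * B / (2 * n - j + 2)%N%:R * 'C(2 * n - j + 2, n - l)%:R)
    * (A - B) ^+ j * B ^ (n%:Z - j%:Z - 1).
  rewrite fcoef_Cab_expr; last by lia.
  rewrite mulr_sumr; apply: eq_bigr => -[j /=]; rewrite ltnS => lej _.
  have -> : (2 * (n - l) + (2 * l).+2 - j = 2 * n - j + 2)%N by lia.
  have -> : (2 * l).+2 = (2 * l.+1)%N by lia.
  have := B_expzS j (l + (n - l - j))%N; rewrite exprD natrM => /(_ ltac:(lia)) B_split.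
  set p := B ^+ l in B_split *; set q := B ^+ _ in B_split *; set z := B ^ _ in B_split *.
  rewrite [LHS](_ : _ = 'C(n - l, j)%:R * (2%:R * l.+1%:R / (2 * n - j + 2)%N%:R
    * 'C(2 * n - j + 2, n - l)%:R) * (A - B) ^+ j * (p * q)).
    by rewrite -B_split; ring.
  by ring.
have [l0|l_gt0] := posnP l.
  have -> : (dyck_points a b n l)%:R = B ^+ l * fcoef (Cab A B ^+ (2 * l).+2) (n - l).
    by rewrite l0 dyck_points_gf mul1r subn0.
  rewrite up; apply: eq_bigr => j _.
  by rewrite (_ : l%:R = 0) ?l0 // mulr0 !mul0r add0r.
rewrite dyck_points_coef ?l_gt0 // -/A -/B up fcoef_Cab_expr; last by lia.
rewrite mulr_sumr -big_split; apply: eq_bigr => -[j /=]; rewrite ltnS => lej _.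
have -> : (2 * (n - l) + 2 * l - j = 2 * n - j)%N by lia.
rewrite (B_expz j (l.-1 + (n - l - j))%N); last by lia.
by rewrite exprD natrM; ring.
Qed.

Theorem theorem7p1 (a b : nat) (ha : (0 < a)%N) (hb : (0 < b)%N) :
  let A : rat := a%:R in
  let B : rat := b%:R in
  let C : fps rat := Cab A B in
  [/\ dyck_points a b 0 0 = 1%N,
      forall n l : nat, (1 <= n)%N -> (l <= n)%N ->
        (dyck_points a b n l)%:R =
        \sum_(0 <= j < (n - l).+1)
          'C(n - l, j)%:R
          * (2%:R * l%:R * (A - B) / (2 * n - j)%N%:R * 'C(2 * n - j, n - l)%:R
             + 2%:R * (l.+1)%:R * B / (2 * n - j + 2)%N%:R
               * 'C(2 * n - j + 2, n - l)%:R)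
          * (A - B) ^+ j * B ^ (n%:Z - j%:Z - 1)
    & forall n l : nat,
        (* The correction is at the (0,0) entry only: with it in the whole row
           n = 0 the identity fails at n = 0 < l whenever a <> b. *)
        (dyck_points a b n l)%:R
        + (A - B) / B * ((n == 0)%N && (l == 0)%N)%:R
        = riordan (C ^+ 2 + fps_const ((A - B) / B))
                  (fps_const B * fpsX rat * C ^+ 2) n l].
Proof.
(* The first count is read in [int] as the constant coefficient of $C^2$. *)
split.
- apply/eqP; rewrite -(eqr_nat int) dyck_points_gf expr2 fcoefM big_ord1.
  by rewrite fcoef_Cab0 mulr1.
- by move=> n l; exact: dyck_points_sum.
- by move=> n l; apply: dyck_points_riordan; rewrite pnatr_eq0 -lt0n.
Qed.
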